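(* Let $\mathcal{D}$ be a pseudo $(v,k,\lambda)$-design. (i) If $k=\lambda+1$, then $\mathcal{D}$ is obtained from the symmetric $(v-1,1,0)$-design or the symmetric $(v-1,v-2,v-3)$-design by either adding an isolated point (a new point belonging to no block) or adding a new point which belongs to all of the blocks. (ii) If $k=\lambda+2$, then, up to isomorphism, either $\mathcal{D}$ is one of the designs $\mathcal{D}_i=(\{1,\ldots,8\},\mathcal{B}_i)$, $i=1,2,3,4$, where (writing $abcd$ for $\{a,b,c,d\}$) $$\mathcal{B}_1=\{1238,1458,1678,3568,2478,3468,2568\},$$ $$\mathcal{B}_2=\{4567,1458,1678,3568,2478,3468,2568\},$$ $$\mathcal{B}_3=\{4567,2367,1678,3568,2478,3468,2568\},$$ $$\mathcal{B}_4=\{4567,2367,2345,3568,2478,3468,2568\};$$ or $\mathcal{D}$ is obtained by omitting one block either from the unique symmetric $(7,4,2)$-design or from the unique symmetric $(7,3,1)$-design.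
   Context: A pseudo $(v,k,\lambda)$-design is a pair $(X,\mathcal{B})$ where $X$ is a $v$-set and $\mathcal{B}=\{B_1,\ldots,B_{v-1}\}$ is a collection of $v-1$ $k$-subsets (blocks) of $X$ such that any two distinct blocks $B_i,B_j$ intersect in exactly $\lambda$ elements, with $0\le\lambda<k\le v-1$. A symmetric $(v,k,\lambda)$-design consists of $v$ points and $v$ blocks, each block of size $k$, such that every 2-subset of points lies in exactly $\lambda$ blocks (then any two distinct blocks meet in $\lambda$ points). The symmetric $(m,1,0)$-design has as blocks the $m$ singletons of an $m$-set; the symmetric $(m,m-1,m-2)$-design has as blocks all $(m-1)$-subsets of an $m$-set. The symmetric $(7,3,1)$-design is the Fano plane and the symmetric $(7,4,2)$-design is its complement; both are unique up to isomorphism.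
   Formalization: In (ii), block 3568 is corrected to 3578 in every B_i (3568 meets 3468 in 3 points), and two omitted pseudo designs are added: the (7,3,1)-design plus an isolated point (8,3,1), and the (7,4,2)-design plus a point on all blocks (8,5,3). *)

(* Defs.v *)
From mathcomp Require Import all_boot.

Set Implicit Arguments.
Unset Strict Implicit.
Unset Printing Implicit Defensive.

(* Block collections are sets of sets: l < k forces the v - 1 blocks of a
   pseudo design to be pairwise distinct. *)
Definition pseudo_design (X : finType) (B : {set {set X}}) (v k l : nat) : Prop :=
  [/\ #|X| = v,
      #|B| = v - 1,
      (l < k <= v - 1),
      (forall b, b \in B -> #|b| = k) &
      (forall b c, b \in B -> c \in B -> b != c -> #|b :&: c| = l)].

Definition symmetric_design (X : finType) (B : {set {set X}}) (v k l : nat) : Prop :=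
  [/\ #|X| = v,
      #|B| = v,
      (forall b, b \in B -> #|b| = k) &
      (forall P : {set X}, #|P| = 2 -> #|[set b in B | P \subset b]| = l)].

Definition design_iso (X Y : finType) (B : {set {set X}}) (C : {set {set Y}}) : Prop :=
  exists2 f : X -> Y, bijective f & [set f @: b | b : {set X} in B] = C.

(* The new point is None. *)
Definition add_isolated_point (Y : finType) (C : {set {set Y}}) : {set {set option Y}} :=
  [set Some @: c | c : {set Y} in C].

Definition add_full_point (Y : finType) (C : {set {set Y}}) : {set {set option Y}} :=
  [set None |: Some @: c | c : {set Y} in C].

(* The point p of {1, ..., 8} is the ordinal p - 1. *)
Definition pt (p : nat) : 'I_8 := inord p.-1.

Definition blk (a b c d : nat) : {set 'I_8} := [set pt a; pt b; pt c; pt d].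

(* 3578, not 3568: {3,5,6,8} would meet {3,4,6,8} in three points. *)
Definition D1 : {set {set 'I_8}} :=
  [set blk 1 2 3 8; blk 1 4 5 8; blk 1 6 7 8; blk 3 5 7 8;
       blk 2 4 7 8; blk 3 4 6 8; blk 2 5 6 8].

Definition D2 : {set {set 'I_8}} :=
  [set blk 4 5 6 7; blk 1 4 5 8; blk 1 6 7 8; blk 3 5 7 8;
       blk 2 4 7 8; blk 3 4 6 8; blk 2 5 6 8].

Definition D3 : {set {set 'I_8}} :=
  [set blk 4 5 6 7; blk 2 3 6 7; blk 1 6 7 8; blk 3 5 7 8;
       blk 2 4 7 8; blk 3 4 6 8; blk 2 5 6 8].

Definition D4 : {set {set 'I_8}} :=
  [set blk 4 5 6 7; blk 2 3 6 7; blk 2 3 4 5; blk 3 5 7 8;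
       blk 2 4 7 8; blk 3 4 6 8; blk 2 5 6 8].

(* Main.v *)
Require Import Defs.
From mathcomp Require Import all_boot zify.

Set Implicit Arguments.
Unset Strict Implicit.
Unset Printing Implicit Defensive.

(* (i) Blocks of size l + 1 meeting pairwise in l points either share l points
   or all lie in a set of l + 2 points; counting blocks pins down which of the
   four designs occurs.
   (ii) Fix a block b. Every other block c swaps a pair b \ c for a pair c \ b,
   and for distinct c, d the pairs satisfy
   |(b \ c) :&: (b \ d)| + |(c \ b) :&: (d \ b)| = 2.
   A family of seven such couples of pairs needs more points than there are,
   so v <= 8. The remaining cases are finite: the first two blocks can be put
   in a standard position, and an exhaustive search over the incidence vectors
   of the other blocks only meets isomorphic copies of the listed designs. *)

(** * Blocks of size l + 1 *)

Lemma design_iso_sym (X Y : finType) (B : {set {set X}}) (C : {set {set Y}}) :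
  design_iso B C -> design_iso C B.
Proof.
case=> f [g fK gK] <-; exists g; first by exists f.
rewrite -imset_comp (eq_imset (g := id)) ?imset_id // => b /=.
by rewrite -imset_comp (eq_imset (g := id)) ?imset_id.
Qed.

Lemma symmetric_design_singletons (Y : finType) :
  symmetric_design [set [set y] | y : Y] #|Y| 1 0.
Proof.
split=> //; first by rewrite card_imset //; apply: set1_inj.
  by move=> _ /imsetP[y _ ->]; rewrite cards1.
move=> P cP; apply/eqP; rewrite cards_eq0; apply/eqP/setP=> b; rewrite !inE.
apply/andP=> -[/imsetP[y _ ->] /subset_leq_card]; by rewrite cP cards1.
Qed.

(** A pair [P] lies in [~: [set y]] exactly when [y] is outside [P], which leaves [#|Y| - 2] choices
    of [y]. *)
Lemma symmetric_design_cosingletons (Y : finType) :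
  symmetric_design [set ~: [set y] | y : Y] #|Y| (#|Y| - 1) (#|Y| - 2).
Proof.
have inj : injective (fun y : Y => ~: [set y]) by move=> x y /setC_inj/set1_inj.
split=> //; first by rewrite card_imset.
  by move=> _ /imsetP[y _ ->]; rewrite cardsCs setCK cards1.
move=> P cP; rewrite -cP -[in RHS](setCK P) -cardsCs -(card_imset _ inj); congr #|pred_of_set _|.
apply/setP=> b; rewrite inE; apply/andP/imsetP=> [[/imsetP[y _ ->] sP]|[y yP ->]].
  by exists y => //; rewrite inE -disjoints1 disjoint_sym disjoints_subset.
split; first exact: imset_f.
by rewrite -disjoints_subset disjoint_sym disjoints1 -in_setC.
Qed.

(** * Collections indexed by all points but one *)

Section Puncture.
Variables (X : finType) (p : X).
Let Y : finType := {x : X | x != p}.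
(** Identifies [option Y] with [X]: the removed point [p] takes the place of the new point
    [None]. *)
Let g (o : option Y) := oapp val p o.

Lemma card_punctured : #|Y| = #|X| - 1.
Proof. by rewrite card_sig -[RHS]/(#|X| - 1) (cardC1 p) subn1. Qed.

Let g_bij : bijective g.
Proof.
exists insub => [[y|]|x] /=; first exact: valK.
  by rewrite insubF ?eqxx.
by rewrite /g; case: insubP => //= /negbNE/eqP.
Qed.

Variables (B : {set {set X}}) (h : X -> {set X}) (c : Y -> {set Y}).
Hypothesis cardB : #|B| = #|X| - 1.
Hypothesis hB : forall b, b \in B -> exists2 x, x != p & b = h x.

(** The family on the right has at most [#|Y|] members, and [B], contained in it, already has that
    many. *)
Lemma punctured_blocks : B = [set h (val y) | y : Y].
Proof.
apply/eqP; rewrite eqEcard cardB -card_punctured leq_imset_card andbT.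
by apply/subsetP=> b /hB[x xp ->]; apply/imsetP; exists (Sub x xp).
Qed.

Lemma punctured_isolated : (forall y, h (val y) = val @: c y) ->
  design_iso B (add_isolated_point [set c y | y : Y]).
Proof.
move=> hE; apply: design_iso_sym; exists g => //.
rewrite punctured_blocks /add_isolated_point -!imset_comp; apply: eq_imset => y /=.
by rewrite hE -imset_comp.
Qed.

Lemma punctured_full : (forall y, h (val y) = p |: val @: c y) ->
  design_iso B (add_full_point [set c y | y : Y]).
Proof.
move=> hE; apply: design_iso_sym; exists g => //.
rewrite punctured_blocks /add_full_point -!imset_comp; apply: eq_imset => y /=.
by rewrite hE imsetU imset_set1 -imset_comp.
Qed.
End Puncture.

Lemma val_setC1 (X : finType) (p : X) (y : {x : X | x != p}) :
  ~: [set p; val y] = val @: ~: [set y].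
Proof.
apply/setP=> x; rewrite !inE negb_or.
apply/andP/imsetP=> [[xp xy]|[z zy ->]].
  by exists (Sub x xp); rewrite // !inE -val_eqE.
by split; [exact: (valP z) | move: zy; rewrite !inE -val_eqE].
Qed.

Lemma exists_missing (X : finType) (B : {set {set X}}) (h : X -> {set X}) :
  injective h -> #|B| < #|X| -> exists p, h p \notin B.
Proof.
move=> inj lt; apply/existsP; rewrite -negb_forall; apply: contraL lt => /forallP all.
rewrite -leqNgt -cardsT -(card_imset _ inj); apply: subset_leq_card.
by apply/subsetP=> _ /imsetP[x _ ->].
Qed.

Section NearPencil.
Variables (X : finType) (B : {set {set X}}) (l : nat).
Hypothesis cardB : #|B| = #|X| - 1.
Hypothesis leX : l + 1 <= #|X| - 1.
Hypothesis szB : forall b, b \in B -> #|b| = l + 1.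
Hypothesis ints : forall b c, b \in B -> c \in B -> b != c -> #|b :&: c| = l.

(** There is one block fewer than there are points, so one point is left over as an index; this [p]
    becomes the added point. *)
Definition indexed_off_point (h : X -> X -> {set X}) :=
  exists p, forall b, b \in B -> exists2 x, x != p & b = h p x.

(** Relative to the points other than [p], the four cases are: singletons, singletons with [p]
    added, complements of singletons, and these complements with [p] added. For [l > 0] the proof
    compares all blocks with the intersection [S] and the union [U] of two fixed blocks. *)
Lemma near_pencil : [\/ indexed_off_point (fun _ x => [set x]), indexed_off_point (fun p x => [set p; x]),
  indexed_off_point (fun p x => ~: [set p; x]) | indexed_off_point (fun _ x => ~: [set x])].
Proof.
have ltB : #|B| < #|X| by lia.
have [l0|lgt0] := posnP l.
  constructor 1; have [p pB] := exists_missing set1_inj ltB; exists p => b bB.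
  have /cards1P[x ex] : #|b| == 1 by rewrite szB // l0.
  by exists x => //; apply: contraNneq pB => <-; rewrite -ex.
have /card_gt1P[b [c [bB cB nbc]]] : 1 < #|B| by lia.
pose S := b :&: c; pose U := b :|: c.
have cS : #|S| = l by apply: ints.
have cU : #|U| = l + 2 by rewrite cardsU (ints bB cB nbc) (szB bB) (szB cB); lia.
have cardU d : #|d :&: U| = #|d :&: b| + #|d :&: c| - #|d :&: S|.
  by rewrite setIUr cardsU setIACA setIid.
case: (boolP [forall d in B, S \subset d]) => [/forall_inP sub|].
  have dE d : d \in B -> exists2 x, x \in ~: S & d = x |: S.
    move=> dB; have /cards1P[x ex] : #|d :\: S| == 1.
      by rewrite cardsD (setIidPr (sub d dB)) szB // cS addKn.
    exists x; first by have := set11 x; rewrite -ex !inE => /andP[].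
    by rewrite -ex setUC -{1}(setIidPr (sub d dB)) setID.
  (* A block is determined by its one point outside [S], so [v - 1 <= v - l]; as [l > 0], this makes
     [S] a single point. *)
  have : #|B| <= #|~: S|.
    apply: leq_trans (leq_imset_card (fun x => x |: S) _); apply: subset_leq_card.
    by apply/subsetP=> d /dE[x xS ->]; apply: imset_f.
  rewrite [#|~: S|]cardsCs setCK cS cardB => le.
  have /cards1P[p ep] : #|S| == 1 by rewrite cS; lia.
  constructor 2; exists p => d /dE[x]; rewrite ep !inE => xp ->; exists x => //.
  by rewrite setUC.
case/forall_inPn=> d dB nSd.
have ltS (e : {set X}) : ~~ (S \subset e) -> #|e :&: S| < l.
  move=> nS; rewrite -cS ltn_neqAle subset_leq_card ?subsetIr // andbT.
  by apply: contra nS => eq; apply/setIidPr/eqP; rewrite eqEcard subsetIr (eqP eq) /=.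
(* Such a block meets [U] in [2 * l - #|e :&: S|] points, which is more than [l], hence in all its
   [l + 1] points. *)
have sub1 e : e \in B -> ~~ (S \subset e) -> e \subset U /\ #|e :&: S| < l.
  move=> eB nS; have ltl := ltS e nS; split=> //.
  have neb : e != b by apply: contraNneq nS => ->; apply: subsetIl.
  have nec : e != c by apply: contraNneq nS => ->; apply: subsetIr.
  apply/setIidPl/eqP; rewrite eqEcard subsetIl cardU (ints eB bB neb) (ints eB cB nec) szB //.
  by move: ltl; clear; lia.
have [dU ltd] := sub1 d dB nSd.
(* A block containing [S], other than [b] and [c], would meet [U] exactly in [S]; then [d], which
   lies in [U], would meet it inside [S], in fewer than [l] points. *)
have subU e : e \in B -> e \subset U.
  move=> eB; case: (boolP (S \subset e)) => [sS|/(sub1 e eB)[]//].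
  case: (eqVneq e b) => [->|neb]; first exact: subsetUl.
  case: (eqVneq e c) => [->|nec]; first exact: subsetUr.
  have : #|e :&: U| = l by rewrite cardU (ints eB bB neb) (ints eB cB nec) (setIidPr sS) cS addnK.
  move=> ceU; have eU : e :&: U = S.
    apply/esym/eqP; rewrite eqEcard ceU cS leqnn andbT subsetI sS.
    exact: subset_trans (subsetIl _ _) (subsetUl _ _).
  have ned : d != e by apply: contraNneq nSd => ->.
  by move: ltd; rewrite -eU (setIC e) setIA (setIidPl dU) ints // ltnn.
have eE e : e \in B -> exists2 x, x \in U & e = U :\ x.
  move=> eB; have /cards1P[x ex] : #|U :\: e| == 1.
    rewrite cardsD (setIidPr (subU e eB)) (szB eB) cU; clear; lia.
  exists x; first by have := set11 x; rewrite -ex !inE => /andP[].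
  by rewrite -ex setDDr setDv set0U (setIidPr (subU e eB)).
(* If [X] is larger than [U], then [v - 1 <= l + 2] leaves a single point outside [U], and it lies
   on no block. Otherwise [U] is all of [X], and a point whose complement is not a block lies on
   every block. *)
case: (ltngtP #|X| (l + 2)) => [|gt|eqX]; first by lia.
  have : #|B| <= #|U|.
    apply: leq_trans (leq_imset_card (fun x => U :\ x) _); apply: subset_leq_card.
    by apply/subsetP=> e /eE[x xS ->]; apply: imset_f.
  rewrite cU cardB => le.
  have /cards1P[p ep] : #|~: U| == 1 by rewrite cardsCs setCK cU; lia.
  have UE : U = ~: [set p] by rewrite -ep setCK.
  constructor 3; exists p => e /eE[x]; rewrite UE !inE => xp ->; exists x => //.
  by rewrite setCU setDE.
constructor 4; have inj : injective (fun x : X => ~: [set x]) by move=> x y /setC_inj/set1_inj.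
have [p pB] := exists_missing inj ltB; exists p => e eB.
have [x _ ex] := eE e eB.
have UT : U = setT by apply/eqP; rewrite eqEcard subsetT cardsT eqX cU leqnn.
rewrite UT setTD in ex; exists x => //.
by apply: contraNneq pB => <-; rewrite -ex.
Qed.
End NearPencil.

Lemma pseudo_design_succ (X : finType) (B : {set {set X}}) v l :
  pseudo_design B v (l + 1) l ->
     exists (Y : finType) (C : {set {set Y}}),
       (symmetric_design C (v - 1) 1 0 \/
        symmetric_design C (v - 1) (v - 2) (v - 3)) /\
       (design_iso B (add_isolated_point C) \/
        design_iso B (add_full_point C)).
Proof.
case=> <- cB /andP[_ lv] szB ints.
have s1 (p : X) := symmetric_design_singletons {x : X | x != p}.
have s2 (p : X) := symmetric_design_cosingletons {x : X | x != p}.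
have cY (p : X) : #|{: {x : X | x != p}}| = #|X| - 1 := card_punctured p.
case: (near_pencil cB lv szB ints) => -[p hB]; exists {x : X | x != p}.
- exists [set [set y] | y : {x : X | x != p}]; rewrite -(cY p); split; first by left.
  by left; apply: (punctured_isolated cB hB) => y; rewrite imset_set1.
- exists [set [set y] | y : {x : X | x != p}]; rewrite -(cY p); split; first by left.
  by right; apply: (punctured_full cB hB) => y; rewrite imset_set1.
- exists [set ~: [set y] | y : {x : X | x != p}]; split.
    by right; have := s2 p; rewrite cY -!subnDA.
  by left; apply: (punctured_isolated cB hB) => y; apply: val_setC1.
exists [set ~: [set y] | y : {x : X | x != p}]; split.
  by right; have := s2 p; rewrite cY -!subnDA.
right; apply: (punctured_full cB hB) => y; rewrite -val_setC1.
apply/setP=> x; rewrite !inE; case: (eqVneq x p) => /= [->|//].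
by rewrite eq_sym; exact: valP y.
Qed.

(** * At most eight points when k = l + 2 *)

Lemma cardsI_disjoint (T : finType) (A B C : {set T}) : B :&: C = set0 ->
  #|A :&: B| + #|A :&: C| = #|A :&: (B :|: C)|.
Proof.
by move=> BC; rewrite setIUr cardsU setIACA BC setI0 cards0 subn0.
Qed.

(** A set meeting [{x, y}] in one point is described there by one bit, and two such sets share that
    point exactly when their bits agree. *)
Lemma card_transversalI (T : finType) (x y : T) (A B : {set T}) :
  x != y -> #|A :&: [set x; y]| = 1 -> #|B :&: [set x; y]| = 1 ->
  #|A :&: B :&: [set x; y]| = ((x \in A) == (x \in B)).
Proof.
move=> nxy; have cardE (C : {set T}) : #|C :&: [set x; y]| = (x \in C) + (y \in C).
  rewrite (cardsD1 x) (cardsD1 y) [_ :\ x :\ y](_ : _ = set0) ?cards0; last first.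
    by apply/setP=> z; rewrite !inE; case: (z == x); case: (z == y); rewrite /= ?andbF.
  by rewrite !inE eqxx [y == x]eq_sym nxy eqxx orbT !andbT addn0.
rewrite !cardE !inE.
by case: (x \in A); case: (x \in B); case: (y \in A); case: (y \in B).
Qed.

(** * Families of couples of pairs whose intersection sizes add up to two *)

Section Pairs.
Variables (I T : finType) (E : {set I}) (P Q : I -> {set T}).
Hypothesis cardP : {in E, forall c, #|P c| = 2}.
Hypothesis cardQ : {in E, forall c, #|Q c| = 2}.
Hypothesis cardPQ : {in E &, forall c d, c != d -> #|P c :&: P d| + #|Q c :&: Q d| = 2}.

Let arith_ge i q : i <= 1 -> i + q = 2 -> 0 < q.
Proof. by lia. Qed.

Let arith_three x y z u w : 0 < x -> 0 < y -> 0 < z -> x + y = u -> u + z = w -> ~ w <= 2.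
Proof. by lia. Qed.

Let arith_tr i q r u : i + r = 2 -> i + q = 2 -> i <= 1 -> q + r = u -> u <= 2 ->
  [/\ i = 1, q = 1, r = 1 & u = 2].
Proof. by move=> *; split; lia. Qed.

(** Equal sums mean that the bits agree in all three places or in none. In the first case the total
    is at least 3; in the second [same] fails and the total is [n <= 1]. *)
Let arith_inj (p p' a a' z z' same : bool) n :
  p (+) a = p' (+) a' -> a (+) z = a' (+) z' -> (same -> p = p') -> (~~ same -> n <= 1) ->
  (p == p') <= n -> n + ((a == a') + (z == z')) <> 2.
Proof.
by case: same; move: p p' a a' z z' => [] [] [] [] [] [] // _ _ h1 h2;
  try (by have := h1 isT); try have := h2 isT; rewrite /=; lia.
Qed.

(** Suppose [P c = P d] with [c != d], so that [Q c] and [Q d] are disjoint. If a third index has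
    the same [P], an index with a different [P] would need three points in its [Q]; hence [P] is
    constant and the [Q] are disjoint. If there is no third one, the remaining indices inject into
    pairs of bits, so there are at most four of them. *)
Lemma pairs_trichotomy :
  [\/ #|E| <= 6, {in E &, forall c d, c != d -> Q c :&: Q d = set0} | {in E &, injective P}].
Proof.
have eqPQ c d : c \in E -> d \in E -> c != d -> P c = P d -> Q c :&: Q d = set0.
  move=> cE dE ncd eq; have := cardPQ cE dE ncd; rewrite eq setIid cardP // => h.
  by apply/eqP; rewrite -cards_eq0; lia.
have ltP c d : c \in E -> d \in E -> P c != P d -> #|P c :&: P d| <= 1.
  move=> cE dE; apply: contraNT; rewrite -ltnNge => lt.
  have PcE : P c :&: P d = P c by apply/eqP; rewrite eqEcard subsetIl cardP.
  have PdE : P c :&: P d = P d by apply/eqP; rewrite eqEcard subsetIr cardP.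
  by rewrite -PcE PdE.
case: (boolP [exists c in E, exists d in E, (c != d) && (P c == P d)]); last first.
  move=> /exists_inPn no; constructor 3 => c d cE dE eq; apply/eqP.
  have /exists_inPn/(_ d dE) := no c cE; apply: contraNT => ->; by rewrite eq eqxx.
case/exists_inP=> c cE /exists_inP[d dE /andP[ncd /eqP ecd]].
case: (boolP [exists e in E, [&& e != c, e != d & P e == P c]]).
  case/exists_inP=> e eE /and3P[nec ned /eqP ePc].
  suff allP f : f \in E -> P f = P c.
    by constructor 2 => f g fE gE nfg; apply: eqPQ => //; rewrite !allP.
  move=> fE; apply/eqP/negPn/negP => ne.
  have Qge x : x \in E -> P x = P c -> 1 <= #|Q f :&: Q x|.
    move=> xE ex; have nfx : f != x by apply: contraNneq ne => ->; rewrite ex.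
    have := cardPQ fE xE nfx; rewrite ex.
    exact: arith_ge (ltP f c fE cE ne).
  have Qcd := eqPQ c d cE dE ncd ecd.
  have Qe : (Q c :|: Q d) :&: Q e = set0.
    by rewrite setIUl (eqPQ c e) ?(eqPQ d e) ?setU0 // 1?eq_sym // -?ecd ePc.
  have le := subset_leq_card (subsetIl (Q f) (Q c :|: Q d :|: Q e)); rewrite cardQ // in le.
  exact: (arith_three (Qge c cE erefl) (Qge d dE (esym ecd)) (Qge e eE ePc)
    (cardsI_disjoint (Q f) Qcd) (cardsI_disjoint (Q f) Qe) le).
move=> /exists_inPn no; constructor 1.
have [p [p' [npp eP]]] : exists p p', p != p' /\ P c = [set p; p'] by apply/cards2P/eqP/cardP.
have [a [a' [naa eQc]]] : exists p p', p != p' /\ Q c = [set p; p'] by apply/cards2P/eqP/cardQ.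
have [z [z' [nzz eQd]]] : exists p p', p != p' /\ Q d = [set p; p'] by apply/cards2P/eqP/cardQ.
have Qcd := eqPQ c d cE dE ncd ecd.
(* As [P e] shares at most one point with [P c = P d], the set [Q e] needs a point in each of the
   disjoint pairs [Q c] and [Q d]; having only two points, it has exactly one in each. *)
have tr e : e \in E :\ c :\ d -> [/\ e \in E, #|P e :&: P c| = 1, #|Q e :&: Q c| = 1,
    #|Q e :&: Q d| = 1 & Q e \subset Q c :|: Q d].
  rewrite !inE => /and3P[ned nec eE]; have := no e eE; rewrite nec ned /= => nP.
  have sub := subsetIl (Q e) (Q c :|: Q d).
  have lt := subset_leq_card sub; rewrite cardQ // in lt.
  have eq1 := cardPQ eE cE nec; have eq2 := cardPQ eE dE ned; rewrite -ecd in eq2.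
  have [I1 I2 I3 I4] := arith_tr eq2 eq1 (ltP e c eE cE nP) (cardsI_disjoint (Q e) Qcd) lt.
  by split=> //; apply/setIidPl/eqP; rewrite eqEcard sub cardQ // I4.
(* An outside block meets P c, Q c and Q d in one point each, so it is described
   by three bits; cardPQ separates the blocks by the pairwise sums of the bits. *)
pose psi e := ((p \in P e) (+) (a \in Q e), (a \in Q e) (+) (z \in Q e)).
suff inj : {in E :\ c :\ d &, injective psi}.
  have := leq_trans (eq_leq (esym (card_in_imset inj))) (max_card _).
  rewrite card_prod card_bool (cardsD1 c E) (cardsD1 d (E :\ c)) cE inE dE.
  by rewrite in_set1 eq_sym ncd; lia.
move=> e f eE' fE' [eq1 eq2]; apply/eqP/negPn/negP => nef.
have [eE Pe Qce Qde /setIidPl Qe] := tr e eE'; have [fE Pf Qcf Qdf _] := tr f fE'.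
have sum2 := cardPQ eE fE nef.
have sub := subset_leq_card (subsetIl (P e :&: P f) (P c)).
have QeE : #|Q e :&: Q f| = #|Q e :&: Q f :&: Q c| + #|Q e :&: Q f :&: Q d|.
  by rewrite cardsI_disjoint // setIAC Qe.
rewrite QeE in sum2.
rewrite eP eQc eQd in Pe Pf Qce Qcf Qde Qdf sum2 sub.
rewrite !card_transversalI // in sum2 sub.
by apply: (arith_inj (same := P e == P f) eq1 eq2 _ (ltP e f eE fE) sub sum2) => /eqP->.
Qed.

Lemma card_disjoint_pairs (A : {set T}) : {in E, forall c, Q c \subset A} ->
  {in E &, forall c d, c != d -> Q c :&: Q d = set0} -> 2 * #|E| <= #|A|.
Proof.
move=> sA dis; have injQ : {in E &, injective Q}.
  move=> c d cE dE eq; apply/eqP/negPn/negP => ncd.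
  by have := cardQ dE; have := dis c d cE dE ncd; rewrite eq setIid => ->; rewrite cards0.
have /eqP <- : #|cover (Q @: E)| == 2 * #|E|.
  have /eqP <- : trivIset (Q @: E).
    apply/trivIsetP=> _ _ /imsetP[c cE ->] /imsetP[d dE ->] ne.
    by rewrite -setI_eq0 dis //; apply: contraNneq ne => ->.
  rewrite (eq_bigr (fun=> 2)) => [|_ /imsetP[c cE ->]]; last exact: cardQ.
  by rewrite sum_nat_const card_in_imset // mulnC.
by apply/subset_leq_card/bigcupsP=> _ /imsetP[c cE ->]; apply: sA.
Qed.

(** When both maps are injective, neither intersection can have two points, so both have one. Thus
    for [d != c] the pair [P d] consists of a point of [P c] and one of the [#|A| - 2] points of [A]
    outside it. *)
Lemma card_intersecting_pairs (A : {set T}) c : c \in E -> {in E, forall c, P c \subset A} ->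
  {in E &, injective P} -> {in E &, injective Q} -> #|E| <= 1 + 2 * (#|A| - 2).
Proof.
move=> cE sA injP injQ; rewrite (cardsD1 c) cE leq_add2l.
rewrite -(card_in_imset (f := P)); last first.
  by move=> d e /setD1P[_ dE] /setD1P[_ eE]; apply: injP.
have <- : #|setX (P c) (A :\: P c)| = 2 * (#|A| - 2).
  by rewrite cardsX cardsD (setIidPr (sA c cE)) cardP.
apply: leq_trans (leq_imset_card (fun u => [set u.1; u.2]) _).
apply/subset_leq_card/subsetP=> _ /imsetP[d /setD1P[ndc dE] ->].
have lt2 (R : I -> {set T}) : {in E, forall c, #|R c| = 2} -> {in E &, injective R} ->
    #|R d :&: R c| < 2.
  move=> cardR injR; rewrite ltnNge; apply: contra ndc => le.
  apply/eqP/injR => //; apply/eqP; rewrite eqEcard !cardR //= andbT.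
  by apply/setIidPl/eqP; rewrite eqEcard subsetIl cardR.
have sum2 := cardPQ dE cE ndc.
have I1 : #|P d :&: P c| = 1 by have := lt2 P cardP injP; have := lt2 Q cardQ injQ; lia.
have /eqP/cards1P[x ex] := I1.
have /cards1P[y ey] : #|P d :\: P c| == 1 by rewrite cardsD I1 cardP.
have /setIP[xd xc] : x \in P d :&: P c by rewrite ex set11.
have /setDP[yd yc] : y \in P d :\: P c by rewrite ey set11.
apply/imsetP; exists (x, y); first by rewrite !inE /= xc yc (subsetP (sA d dE)).
by rewrite -[LHS](setID _ (P c)) ex ey.
Qed.
End Pairs.

(** The trichotomy is applied to [P], [Q] and again with their roles exchanged. Disjoint pairs would
    need [2 * (v - 2)] points inside [~: b] or inside [b]. If both maps are injective, [v - 2] is at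
    most [1 + 2 * l] and at most [1 + 2 * (v - l - 4)], and the sum of these bounds is too small. *)
Lemma pseudo_design_order (X : finType) (B : {set {set X}}) v l :
  pseudo_design B v (l + 2) l -> v <= 8.
Proof.
case=> cX cB /andP[_ klv] szB ints; rewrite leqNgt; apply/negP=> v9.
have /card_gt0P[b bB] : 0 < #|B| by lia.
pose E := B :\ b; pose P (c : {set X}) := b :\: c; pose Q (c : {set X}) := c :\: b.
have cE : #|E| = v - 2 by have := cardsD1 b B; rewrite bB cB -/E; lia.
have cardP : {in E, forall c, #|P c| = 2}.
  move=> c /setD1P[ncb cB']; rewrite cardsD ints ?szB 1?eq_sym //; lia.
have cardQ : {in E, forall c, #|Q c| = 2}.
  move=> c /setD1P[ncb cB']; rewrite cardsD ints ?szB //; lia.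
(* If [x] points are common to [b], [c] and [d], the two terms are [2 - l + x] and [l - x]. *)
have cardPQ : {in E &, forall c d, c != d -> #|P c :&: P d| + #|Q c :&: Q d| = 2}.
  move=> c d /setD1P[ncb cB'] /setD1P[ndb dB] ncd.
  have -> : P c :&: P d = b :\: (c :|: d) by rewrite /P setDUr.
  have -> : Q c :&: Q d = (c :&: d) :\: b by rewrite /Q setDIl.
  have := subset_leq_card (subsetIl b (c :|: d)).
  rewrite !cardsD setIUr cardsU setIACA setIid [_ :&: b]setIC.
  have := subset_leq_card (subsetIl (c :&: d) b); rewrite [_ :&: b]setIC.
  rewrite (szB b) // (ints c d) // (ints b c) 1?eq_sym // (ints b d) 1?eq_sym //.
  by move: #|b :&: (c :&: d)|; clear; lia.
have cardQP : {in E &, forall c d, c != d -> #|Q c :&: Q d| + #|P c :&: P d| = 2}.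
  by move=> c d *; rewrite addnC cardPQ.
have sP : {in E, forall c, P c \subset b} by move=> c _; apply: subsetDl.
have sQ : {in E, forall c, Q c \subset ~: b}.
  by move=> c _; apply/subsetP=> x; rewrite !inE => /andP[].
have cCb : #|~: b| = v - (l + 2) by rewrite cardsCs setCK cX szB.
have cb : #|b| = l + 2 by apply: szB.
case: (pairs_trichotomy cardP cardQ cardPQ) => [|disQ|injP]; first lia.
  have := card_disjoint_pairs cardQ sQ disQ; lia.
case: (pairs_trichotomy cardQ cardP cardQP) => [|disP|injQ]; first lia.
  have := card_disjoint_pairs cardP sP disP; lia.
have /card_gt0P[c cE'] : 0 < #|E| by lia.
have := card_intersecting_pairs cardP cardQ cardPQ cE' sP injP injQ.
have := card_intersecting_pairs cardQ cardP cardQP cE' sQ injQ injP.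
lia.
Qed.

(** * Exhaustive search over incidence vectors *)

(** The size of an intersection, read off two incidence vectors. *)
Definition meet (m1 m2 : bitseq) := count id (mask m1 m2).

Fixpoint bitseqs n : seq bitseq :=
  if n is n'.+1 then [seq b :: m | b <- [:: true; false], m <- bitseqs n']
  else [:: [::]].

Section Search.
Variables (T : eqType) (R : rel T) (good : seq T -> bool).

(* Tests [good] on all n-subsequences of cand that, together with acc, are
   pairwise related by R. *)
Fixpoint search n (acc cand : seq T) : bool :=
  if n is n'.+1 then
    if cand is c :: cand' then
      ((size cand' < n) || search n acc cand') &&
      (all (R c) acc ==> search n' (c :: acc) cand')
    else true
  else good acc.
End Search.

Definition permute (p : seq nat) (m : bitseq) := [seq nth false m i | i <- p].

(* Looks for a coordinate permutation extending p by n entries and mapping F to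
   G up to order; comparing prefixes only prunes the search. *)
Fixpoint iso_search (F G : seq bitseq) n (p : seq nat) : bool :=
  if n is n'.+1 then
    has (fun i => (i \notin p) && let p' := rcons p i in
      perm_eq [seq permute p' m | m <- F] [seq take (size p') m | m <- G]
      && iso_search F G n' p') (iota 0 (size (head [::] F)))
  else perm_eq [seq permute p m | m <- F] G.

(** Points are numbered from 1 in [l], positions of the vector from 0. *)
Definition bits v (l : seq nat) : bitseq := [seq i.+1 \in l | i <- iota 0 v].

Definition fano := [seq bits 7 l | l <- [:: [:: 1; 2; 3]; [:: 1; 4; 5];
  [:: 1; 6; 7]; [:: 3; 5; 7]; [:: 2; 4; 7]; [:: 3; 4; 6]; [:: 2; 5; 6]]].
Definition cofano := [seq [seq ~~ x | x <- m] | m <- fano].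

Definition d1 := [seq bits 8 l | l <- [:: [:: 1; 2; 3; 8]; [:: 1; 4; 5; 8];
  [:: 1; 6; 7; 8]; [:: 3; 5; 7; 8]; [:: 2; 4; 7; 8]; [:: 3; 4; 6; 8]; [:: 2; 5; 6; 8]]].
Definition d2 := bits 8 [:: 4; 5; 6; 7] :: behead d1.
Definition d3 := [:: bits 8 [:: 4; 5; 6; 7], bits 8 [:: 2; 3; 6; 7] & drop 2 d1].
Definition d4 := [:: bits 8 [:: 4; 5; 6; 7], bits 8 [:: 2; 3; 6; 7], bits 8 [:: 2; 3; 4; 5] & drop 3 d1].

(** For [v = 7]: the Fano plane or its complement without a block, where the first block may stand
    for any, the automorphism group being transitive on blocks. For [v = 8]: the Fano plane with an
    isolated point, the four listed designs, and the complement of the Fano plane with a point on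
    all blocks. *)
Definition targets (v l : nat) : seq (seq bitseq) :=
  match v, l with
  | 7, 1 => [:: behead fano]
  | 7, 2 => [:: behead cofano]
  | 8, 1 => [:: map (cons false) fano]
  | 8, 2 => [:: d1; d2; d3; d4]
  | 8, 3 => [:: map (cons true) cofano]
  | _, _ => [::]
  end.

(** [block0] and [block1] are two blocks in standard position: the points are listed as those on
    both, on the first only, on the second only, and on neither. *)
Definition block0 v l := nseq (l + 2) true ++ nseq (v - l - 2) false.
Definition block1 v l := nseq l true ++ [:: false; false; true; true] ++ nseq (v - l - 4) false.

(** Two of the [v - 1] blocks are fixed, so [v - 3] remain to be chosen; the candidates already have
    the right size and meet both fixed blocks correctly. *)
Definition classified v l :=
  let b0 := block0 v l in let b1 := block1 v l in
  search (fun m m' => meet m m' == l)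
    (fun F => has (fun G => iso_search F G v [::]) (targets v l))
    (v - 3) [:: b0; b1]
    [seq m <- bitseqs v | (count id m == l + 2) && (meet m b0 == l) && (meet m b1 == l)].

(** One branch of the search takes exactly the candidates satisfying [p]. They are pushed one by one
    onto [acc], whence the [catrev]. *)
Lemma search_sound (T : eqType) (R : rel T) (good : seq T -> bool) n acc cand (p : pred T) :
  search R good n acc cand -> uniq (acc ++ filter p cand) ->
  {in acc ++ filter p cand &, forall x y, x != y -> R x y} ->
  size (filter p cand) = n -> good (catrev (filter p cand) acc).
Proof.
elim: cand n acc => [|c cand IH] [|n] acc //=.
  by case: (p c) => // gd _ _ /size0nil ->.
case/andP=> skip add; case: (p c) => /= uq cl sz.
  move: add; have -> : all (R c) acc.
    apply/allP=> x xacc; apply: cl; rewrite ?mem_cat ?mem_head ?orbT ?xacc //.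
    apply: contraTneq uq => ->; rewrite cat_uniq /= xacc /=.
    by rewrite andbF.
  have pq : perm_eq (acc ++ c :: filter p cand) (c :: acc ++ filter p cand).
    by rewrite perm_catC /= perm_cons perm_catC.
  move=> add; apply: (IH n) => //; last by case: sz.
    by rewrite -(perm_uniq pq).
  by move=> x y xin yin; apply: cl; rewrite (perm_mem pq).
(* The branch is pruned only when too few candidates are left to supply the required number. *)
case/orP: skip => [lt|skip]; last exact: (IH n.+1).
by have := leq_trans (eq_leq (esym sz)) (size_subseq (filter_subseq p cand)); lia.
Qed.

Lemma iso_search_sound F G n p :
  iso_search F G n p -> uniq p -> {subset p <= iota 0 (size (head [::] F))} ->
  exists q, [/\ uniq q, {subset q <= iota 0 (size (head [::] F))}, size q = n + size p
    & perm_eq [seq permute q m | m <- F] G].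
Proof.
elim: n p => [|n IH] p /=; first by move=> *; exists p.
case/hasP=> i iv /and3P[ip _ ok] up sp.
have [||q [uq sq szq pq]] := IH _ ok.
- by rewrite rcons_uniq ip.
- by move=> j; rewrite mem_rcons inE => /orP[/eqP->|/sp].
by exists q; split=> //; rewrite szq size_rcons; lia.
Qed.

Lemma mem_bitseqs m : m \in bitseqs (size m).
Proof. by elim: m => //= -[] m IH; rewrite !mem_cat map_f ?orbT. Qed.

Lemma bitseqs_uniq n : uniq (bitseqs n).
Proof.
elim: n => //= n IH; rewrite cats0 cat_uniq !map_inj_uniq ?IH ?andbT => [|? ? [] //|? ? [] //].
by apply/hasPn=> _ /mapP[m _ ->]; apply/negP=> /mapP[].
Qed.

(** * Incidence vectors of blocks along a listing of the points *)

Section Codes.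
Implicit Types (T U : finType).

Definition code T (s : seq T) (b : {set T}) : bitseq := [seq x \in b | x <- s].

Definition codes T (s : seq T) (B : {set {set T}}) := [seq code s b | b <- enum B].

Lemma count_code T (s : seq T) b : perm_eq s (enum T) -> count id (code s b) = #|b|.
Proof.
move=> es; rewrite count_map (permP es) cardE /enum_mem size_filter count_filter.
by apply: eq_count => x /=; rewrite andbT.
Qed.

Lemma meet_code T (s : seq T) b c : perm_eq s (enum T) ->
  meet (code s b) (code s c) = #|b :&: c|.
Proof.
move=> es; rewrite /meet /code -map_mask -filter_mask -(count_code _ es).
rewrite !count_map count_filter; apply: eq_count => x /=; by rewrite inE andbC.
Qed.

Lemma code_inj T (s : seq T) : perm_eq s (enum T) -> injective (code s).
Proof.
move=> es b c /eq_in_map eq; apply/setP=> x; apply: eq.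
by rewrite (perm_mem es) mem_enum.
Qed.

Lemma perm_enum_set_of T (L : seq T) : uniq L -> perm_eq (enum [set:: L]) L.
Proof. by move=> uL; apply: uniq_perm; rewrite ?enum_uniq // => x; rewrite mem_enum inE. Qed.

Lemma codes_set_of T (s : seq T) (L : seq {set T}) (G : seq bitseq) :
  map (code s) L = G -> uniq G -> perm_eq (codes s [set:: L]) G.
Proof. by move=> <- /map_uniq uL; apply/perm_map/perm_enum_set_of. Qed.

Lemma codes_imset T U (s : seq T) (t : seq U) h g (B : {set {set T}}) :
  injective h -> (forall b, code t (h b) = g (code s b)) ->
  perm_eq (codes t (h @: B)) (map g (codes s B)).
Proof.
move=> inj hg; rewrite /codes -map_comp (eq_map (g := code t \o h)); last by move=> b /=.
rewrite map_comp; apply/perm_map/uniq_perm; rewrite ?enum_uniq ?map_inj_uniq ?enum_uniq //.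
move=> b; rewrite mem_enum; apply/imsetP/mapP=> -[x xB ->]; exists x => //.
  by rewrite mem_enum.
by rewrite -mem_enum.
Qed.

(** The bijection sends each point of [s] to the point of [t] in the same position, so it preserves
    incidence vectors. Nonempty listings supply the default points for [nth]. *)
Lemma design_iso_codes T U (s : seq T) (t : seq U) B C :
  perm_eq s (enum T) -> perm_eq t (enum U) -> 0 < size s -> size s = size t ->
  perm_eq (codes s B) (codes t C) -> design_iso B C.
Proof.
move=> es et nz sz eBC.
have us : uniq s by rewrite (perm_uniq es) enum_uniq.
have ut : uniq t by rewrite (perm_uniq et) enum_uniq.
have ms x : x \in s by rewrite (perm_mem es) mem_enum.
have mt y : y \in t by rewrite (perm_mem et) mem_enum.
case: s t => [|x0 s0] [|y0 t0] // in es et sz eBC us ut ms mt nz *.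
set s := x0 :: s0 in es eBC us ms sz nz *; set t := y0 :: t0 in et eBC ut mt sz *.
pose f x := nth y0 t (index x s); pose g y := nth x0 s (index y t).
have fK : cancel f g by move=> x; rewrite /f /g index_uniq -?sz ?index_mem ?nth_index.
have gK : cancel g f by move=> x; rewrite /f /g index_uniq ?sz ?index_mem ?nth_index.
have fs : map f s = t.
  apply: (@eq_from_nth _ y0); rewrite size_map // => i lt.
  by rewrite (nth_map x0) // /f index_uniq.
have cf (b : {set T}) : code t (f @: b) = code s b.
  rewrite /code -fs -map_comp; apply: eq_map => x /=; exact/mem_imset/(can_inj fK).
exists f; first by exists g.
apply/setP=> c; rewrite -[RHS]mem_enum -(mem_map (code_inj et)) -/(codes t C) -(perm_mem eBC).
have <- : f @: (g @: c) = c by rewrite -imset_comp (eq_imset (g:=id)) ?imset_id.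
rewrite cf (mem_map (code_inj es)) mem_enum; apply: mem_imset.
exact/imset_inj/(can_inj fK).
Qed.
End Codes.

(* With v <= 8, two blocks meeting in l points force l + 4 <= v. *)
Lemma all_classified : all (fun v => all (classified v) (iota 0 (v - 3))) (iota 4 5).
Proof. by lazy. Qed.

(** * From a design to an instance of the search *)

Lemma code_const (T : finType) (A b : {set T}) (e : bool) :
  {in A, forall x, (x \in b) = e} -> code (enum A) b = nseq #|A| e.
Proof.
move=> h; rewrite cardE -(@size_map _ _ (mem b)); apply/all_pred1P/allP=> _ /mapP[x + ->].
by rewrite mem_enum /= => /h ->.
Qed.

Lemma code_cat (T : finType) (s t : seq T) b : code (s ++ t) b = code s b ++ code t b.
Proof. exact: map_cat. Qed.

Lemma normal_listing (X : finType) (b c : {set X}) l :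
  #|b| = l + 2 -> #|c| = l + 2 -> #|b :&: c| = l ->
  exists2 s, perm_eq s (enum X) &
    l + 4 <= #|X| /\ code s b = block0 #|X| l /\ code s c = block1 #|X| l.
Proof.
move=> cb cc ci.
exists (enum (b :&: c) ++ enum (b :\: c) ++ enum (c :\: b) ++ enum (~: (b :|: c))).
  apply: uniq_perm; rewrite ?enum_uniq //; last first.
    by move=> x; rewrite !mem_cat !mem_enum !inE; case: (x \in b); case: (x \in c).
  rewrite !cat_uniq !enum_uniq /= andbT.
  apply/and3P; split; apply/hasPn=> x; rewrite ?mem_cat !mem_enum !inE;
    by case: (x \in b); case: (x \in c).
have d1 : #|b :\: c| = 2 by rewrite cardsD ci cb; lia.
have d2 : #|c :\: b| = 2 by rewrite cardsD setIC ci cc; lia.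
have u : #|b :|: c| = l + 4 by rewrite cardsU ci cb cc; lia.
have lev : l + 4 <= #|X| by rewrite -u max_card.
have d3 : #|~: (b :|: c)| = #|X| - l - 4 by rewrite cardsCs setCK u; lia.
split=> //; rewrite !code_cat; split.
  rewrite (code_const (A := b :&: c) (e := true)); last by move=> x /setIP[].
  rewrite (code_const (A := b :\: c) (e := true)); last by move=> x /setDP[].
  rewrite (code_const (A := c :\: b) (e := false)); last by move=> x /setDP[_ /negPf].
  rewrite (code_const (A := ~: _) (e := false)); last first.
    by move=> x; rewrite !inE negb_or => /andP[/negPf].
  rewrite ci d1 d2 d3 catA -!nseqD /block0; congr (_ ++ nseq _ _); lia.
rewrite (code_const (A := b :&: c) (e := true)); last by move=> x /setIP[].
rewrite (code_const (A := b :\: c) (e := false)); last by move=> x /setDP[_ /negPf].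
rewrite (code_const (A := c :\: b) (e := true)); last by move=> x /setDP[].
rewrite (code_const (A := ~: _) (e := false)) ?ci ?d1 ?d2 ?d3 //.
by move=> x; rewrite !inE negb_or => /andP[_ /negPf].
Qed.

Lemma size_code (T : finType) (s : seq T) b : size (code s b) = size s.
Proof. exact: size_map. Qed.

Lemma permute_code (T : finType) (s : seq T) (x0 : T) q b : {subset q <= iota 0 (size s)} ->
  permute q (code s b) = code [seq nth x0 s i | i <- q] b.
Proof.
move=> sq; rewrite /permute /code -map_comp; apply/eq_in_map => i /sq.
by rewrite mem_iota /= => lt; rewrite (nth_map x0).
Qed.

(** Along a listing that puts two blocks in standard position, the vectors of the other blocks form
    one of the families met by the search. The search returns a coordinate permutation onto a
    target, and relisting the points accordingly absorbs it. *)
Lemma pseudo_design_codes (X : finType) (B : {set {set X}}) v l :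
  pseudo_design B v (l + 2) l -> v <= 8 ->
  exists2 s, perm_eq s (enum X) & exists2 G, G \in targets v l & perm_eq (codes s B) G.
Proof.
case=> cX cB /andP[_ klv] szB ints v8.
have v_gt2 : 2 < v by lia.
have /card_gt1P[b [c [bB cB' nbc]]] : 1 < #|B| by lia.
have [s es [l4 [eb ec]]] := normal_listing (szB b bB) (szB c cB') (ints b c bB cB' nbc).
rewrite cX in l4 eb ec.
have sz : size s = v by rewrite (perm_size es) -cX cardT.
have us : uniq s by rewrite (perm_uniq es) enum_uniq.
have cl : classified v l.
  have /allP/(_ v) := all_classified; rewrite mem_iota => /(_ _)/allP; apply; first lia.
  rewrite mem_iota; lia.
move: cl; rewrite /classified -eb -ec.
pose p := [pred m | m \in codes s (B :\ b :\ c)].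
set cand := filter _ _.
have uC A : uniq (codes s A) by rewrite (map_inj_uniq (code_inj es)) enum_uniq.
have pcand : perm_eq (filter p cand) (codes s (B :\ b :\ c)).
  (* Every remaining block passes the three tests that define the candidates, so selecting by [p]
     loses none of them. *)
  apply: uniq_perm; rewrite ?uC ?filter_uniq ?bitseqs_uniq // => m.
  rewrite mem_filter inE; case: (boolP (m \in codes _ _)) => //= /mapP[d].
  rewrite mem_enum !inE => /and3P[ndc ndb dB] ->.
  rewrite mem_filter !meet_code // count_code // szB // !ints // !eqxx /=.
  by rewrite -sz -(size_code s d) mem_bitseqs.
have pBc : perm_eq (codes s B) ([:: code s b; code s c] ++ filter p cand).
  apply: (@perm_trans _ (map (code s) [:: b, c & enum (B :\ b :\ c)])).
    apply/perm_map/uniq_perm; rewrite ?enum_uniq //=.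
      by rewrite enum_uniq inE !mem_enum !inE !eqxx andbF orbF nbc.
    move=> d; rewrite !inE !mem_enum !inE.
    case: eqP => [->|_] //; by case: eqP => [->|_] //; rewrite cB' orbT.
  by rewrite /= !perm_cons perm_sym.
have cdiff m m' : m \in codes s B -> m' \in codes s B -> m != m' -> meet m m' == l.
  case/mapP=> d; rewrite mem_enum => dB ->; case/mapP=> d'; rewrite mem_enum => dB' -> ne.
  by rewrite meet_code // ints //; apply: contraNneq ne => ->.
move=> srch; have [|||G Gt iso] := hasP (search_sound (p := p) srch _ _ _).
- by rewrite -(perm_uniq pBc).
- by move=> m m' min m'in; apply: cdiff; rewrite (perm_mem pBc).
- by have := perm_size pBc; rewrite /codes size_map -cardE cB /=; clear; lia.
set F := catrev _ _ in iso.
have pBF : perm_eq (codes s B) F.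
  by rewrite (perm_trans pBc) // /F catrevE perm_catC perm_cat2r perm_sym perm_rev.
have hdF : size (head [::] F) = v.
  have : all (fun m => size m == v) F.
    by apply/allP=> m; rewrite -(perm_mem pBF) => /mapP[d _ ->]; rewrite size_code sz.
  have : 0 < size F by rewrite -(perm_size pBF) size_map -cardE cB subn_gt0 ltnW.
  by case: (F) => //= m F' _ /andP[/eqP].
have [//|//|q [uq sq szq pq]] := iso_search_sound iso.
have /hasP[x0 _ _] : has predT s by rewrite has_predT sz (leq_trans _ v_gt2).
rewrite hdF addn0 in sq szq.
(* The points in the order prescribed by [q]; as [q] has [v] distinct entries below [v], this is
   again a full listing. *)
exists [seq nth x0 s i | i <- q].
  have pq' : perm_eq q (iota 0 v).
    have [|_ eq] := uniq_min_size uq sq; first by rewrite size_iota szq.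
    by apply: uniq_perm => //; apply: iota_uniq.
  apply: perm_trans es; rewrite -[X in perm_eq _ X](mkseq_nth x0) /mkseq sz.
  exact: perm_map.
exists G => //; rewrite -(permPr pq).
rewrite /codes; rewrite (eq_map (g := permute q \o code s)) => [|d /=]; last by rewrite (permute_code x0) ?sz.
by rewrite (map_comp (permute q)); apply: perm_map.
Qed.

(** * The designs in the conclusion *)

Lemma code_blk a b c d : all (fun i => 0 < i <= 8) [:: a; b; c; d] ->
  code (enum 'I_8) (blk a b c d) = bits 8 [:: a; b; c; d].
Proof.
move=> lt; rewrite /bits -val_enum_ord -map_comp; apply: eq_map => x /=.
have eq i : 0 < i <= 8 -> (x == pt i) = (x.+1 == i).
  by move=> ?; rewrite -val_eqE /= inordK; lia.
by case/and5P: lt => *; rewrite !inE !eq // !orbA.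
Qed.

Lemma codes_D : [/\ perm_eq (codes (enum 'I_8) D1) d1, perm_eq (codes (enum 'I_8) D2) d2,
  perm_eq (codes (enum 'I_8) D3) d3 & perm_eq (codes (enum 'I_8) D4) d4].
Proof.
have setE (D : {set {set 'I_8}}) L G : D =i L -> map (code (enum 'I_8)) L = G -> uniq G ->
    perm_eq (codes (enum 'I_8) D) G.
  move=> DL LG uG; have -> : D = [set:: L] by apply/setP=> x; rewrite inE DL.
  exact: codes_set_of.
split.
- apply: (setE _ [:: blk 1 2 3 8; blk 1 4 5 8; blk 1 6 7 8; blk 3 5 7 8;
       blk 2 4 7 8; blk 3 4 6 8; blk 2 5 6 8]) => [b||]; rewrite /= ?code_blk //.
  by rewrite !inE -!orbA.
- apply: (setE _ [:: blk 4 5 6 7; blk 1 4 5 8; blk 1 6 7 8; blk 3 5 7 8;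
       blk 2 4 7 8; blk 3 4 6 8; blk 2 5 6 8]) => [b||]; rewrite /= ?code_blk //.
  by rewrite !inE -!orbA.
- apply: (setE _ [:: blk 4 5 6 7; blk 2 3 6 7; blk 1 6 7 8; blk 3 5 7 8;
       blk 2 4 7 8; blk 3 4 6 8; blk 2 5 6 8]) => [b||]; rewrite /= ?code_blk //.
  by rewrite !inE -!orbA.
- apply: (setE _ [:: blk 4 5 6 7; blk 2 3 6 7; blk 2 3 4 5; blk 3 5 7 8;
       blk 2 4 7 8; blk 3 4 6 8; blk 2 5 6 8]) => [b||]; rewrite /= ?code_blk //.
  by rewrite !inE -!orbA.
Qed.

(** The conditions for a symmetric design on incidence vectors, in a form decided by computation. *)
Definition balanced v k l (G : seq bitseq) :=
  [&& size G == v, all (fun m => count id m == k) G &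
    all (fun i => all (fun j => (i == j) ||
      (count (fun m => nth false m i && nth false m j) G == l)) (iota 0 v)) (iota 0 v)].

Lemma symmetric_design_codes (T : finType) (s : seq T) C v k l G :
  perm_eq s (enum T) -> size s = v -> perm_eq (codes s C) G -> balanced v k l G ->
  symmetric_design C v k l.
Proof.
move=> es sz pG /and3P[/eqP szG /allP kG lG]; split.
- by rewrite cardT -(perm_size es).
- by rewrite cardE -(size_map (code s)) (perm_size pG).
- move=> b bC; rewrite -(count_code b es); apply/eqP/kG.
  by rewrite -(perm_mem pG) map_f ?mem_enum.
move=> P /eqP/cards2P[x [y [nxy ->]]].
have idx z : index z s < v by rewrite -sz index_mem (perm_mem es) mem_enum.
have nthc z b : nth false (code s b) (index z s) = (z \in b).
  by rewrite (nth_map z) ?nth_index ?sz ?idx // (perm_mem es) mem_enum.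
move/allP: lG => /(_ (index x s)); rewrite mem_iota idx => /(_ isT)/allP.
move=> /(_ (index y s)); rewrite mem_iota idx => /(_ isT); case/orP.
  by move/eqP/index_inj => eq; case/eqP: nxy; apply: eq; rewrite ?inE ?(perm_mem es) ?mem_enum.
move/eqP=> <-; rewrite -(permP pG) count_map -size_filter cardE.
apply/perm_size/uniq_perm; [exact: enum_uniq | exact/filter_uniq/enum_uniq | move=> b].
by rewrite mem_enum inE mem_filter /= !nthc mem_enum subUset !sub1set andbC.
Qed.

Definition design_of v (G : seq bitseq) : {set {set 'I_v}} :=
  [set:: [seq [set i : 'I_v | nth false m i] | m <- G]].

Lemma code_ord v m : size m = v -> code (enum 'I_v) [set i : 'I_v | nth false m i] = m.
Proof.
move=> sz; rewrite -[RHS](mkseq_nth false) sz /mkseq -val_enum_ord -map_comp.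
by apply: eq_map => i /=; rewrite inE.
Qed.

Lemma codes_design_of v G : all (fun m => size m == v) G -> uniq G ->
  perm_eq (codes (enum 'I_v) (design_of v G)) G.
Proof.
move=> /allP sz uG; apply: codes_set_of => //; rewrite -map_comp -[RHS]map_id.
by apply/eq_in_map => m /sz/eqP /= /code_ord.
Qed.

Lemma design_of_rem v m G : all (fun m => size m == v) (m :: G) -> uniq (m :: G) ->
  design_of v G = design_of v (m :: G) :\ [set i : 'I_v | nth false m i].
Proof.
move=> /allP sz /= /andP[mG uG]; apply/setP=> b; rewrite !inE.
case: eqP => //= ->; apply: contraNF mG => /mapP[m' m'G eq].
rewrite -(@code_ord v m) ?(eqP (sz _ _)) ?mem_head // eq code_ord //.
by apply/eqP/sz; rewrite inE m'G orbT.
Qed.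

(** [None] comes first, so that adding the new point puts one bit in front of every vector, as in
    [targets]. *)
Definition option_enum n : seq (option 'I_n) := None :: map Some (enum 'I_n).

Lemma perm_option_enum n : perm_eq (option_enum n) (enum (option 'I_n : finType)).
Proof.
apply: uniq_perm; rewrite ?enum_uniq //=.
  rewrite map_inj_uniq ?enum_uniq ?andbT => [|? ? [] //].
  by apply/negP=> /mapP[].
case=> [i|]; rewrite mem_enum !inE //= map_f ?mem_enum //.
Qed.

Lemma codes_add_isolated_point n (C : {set {set 'I_n}}) :
  perm_eq (codes (option_enum n) (add_isolated_point C)) (map (cons false) (codes (enum 'I_n) C)).
Proof.
apply: codes_imset => [|b]; first exact/imset_inj/Some_inj.
rewrite /code /= -map_comp; congr (_ :: _); first by apply/imsetP=> -[].
by apply: eq_map => i /=; rewrite mem_imset //; apply: Some_inj.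
Qed.

Lemma codes_add_full_point n (C : {set {set 'I_n}}) :
  perm_eq (codes (option_enum n) (add_full_point C)) (map (cons true) (codes (enum 'I_n) C)).
Proof.
have memS (i : 'I_n) (c : {set 'I_n}) : (Some i \in None |: Some @: c) = (i \in c).
  by rewrite !inE /= mem_imset //; apply: Some_inj.
apply: codes_imset => [b c /setP eq|b].
  by apply/setP=> i; rewrite -!memS eq.
rewrite /code /= -map_comp !inE; congr (_ :: _).
by apply: eq_map => i /=; rewrite memS.
Qed.

(** The vectors of [B] match a target, so an isomorphism only requires that the design named in the
    conclusion has the same vectors along some listing of its points. *)
Lemma pseudo_design_add2 (X : finType) (B : {set {set X}}) v l :
  pseudo_design B v (l + 2) l -> v <= 8 ->
     (design_iso B D1 \/ design_iso B D2 \/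
      design_iso B D3 \/ design_iso B D4)
     \/
     (exists (Y : finType) (C : {set {set Y}}) (c : {set Y}),
        (symmetric_design C 7 4 2 \/ symmetric_design C 7 3 1) /\
        c \in C /\ design_iso B (C :\ c))
     \/
     (exists (Y : finType) (C : {set {set Y}}),
        (symmetric_design C 7 3 1 /\ design_iso B (add_isolated_point C)) \/
        (symmetric_design C 7 4 2 /\ design_iso B (add_full_point C))).
Proof.
move=> des v8; have [s es [G Gt pG]] := pseudo_design_codes des v8.
have [cX cB kv _ _] := des.
have sz : size s = v by rewrite (perm_size es) -cX cardT.
have iso n (U : finType) (t : seq U) C : perm_eq t (enum U) -> v = n -> size t = n ->
    perm_eq (codes t C) G -> design_iso B C.
  move=> et vn szt pC; apply: (design_iso_codes es et); rewrite ?sz ?szt //; first lia.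
  by rewrite (perm_trans pG) // perm_sym.
have e7 := size_enum_ord 7; have e8 := size_enum_ord 8.
have o8 : size (option_enum 7) = 8 by rewrite /= size_map e7.
have po := perm_option_enum 7; have pr n := perm_refl (enum 'I_n).
have pF := @codes_design_of 7 fano isT isT.
have pcF := @codes_design_of 7 cofano isT isT.
have sF : symmetric_design (design_of 7 fano) 7 3 1.
  exact: symmetric_design_codes (pr 7) e7 pF _.
have scF : symmetric_design (design_of 7 cofano) 7 4 2.
  exact: symmetric_design_codes (pr 7) e7 pcF _.
have [c1 c2 c3 c4] := codes_D.
(* Only the five parameter pairs with a nonempty list of targets survive. *)
move: v l {des cX cB kv} Gt sz iso {v8} => [|[|[|[|[|[|[|[|[|?]]]]]]]]] [|[|[|[|?]]]] //;
  rewrite ?[targets _ _]/targets ?inE => Gt sz iso.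
- right; left; exists 'I_7, (design_of 7 fano), [set i : 'I_7 | nth false (head [::] fano) i].
  split; first by right.
  split; first by rewrite inE map_f ?mem_head.
  rewrite -(@design_of_rem 7 _ (behead fano)) //; apply: iso (pr 7) erefl e7 _.
  by rewrite (eqP Gt) codes_design_of.
- right; left; exists 'I_7, (design_of 7 cofano), [set i : 'I_7 | nth false (head [::] cofano) i].
  split; first by left.
  split; first by rewrite inE map_f ?mem_head.
  rewrite -(@design_of_rem 7 _ (behead cofano)) //; apply: iso (pr 7) erefl e7 _.
  by rewrite (eqP Gt) codes_design_of.
- right; right; exists 'I_7, (design_of 7 fano); left; split=> //; apply: iso po erefl o8 _.
  by rewrite (eqP Gt); apply: perm_trans (codes_add_isolated_point _) (perm_map _ pF).
- have isoD D d : perm_eq (codes (enum 'I_8) D) d -> G == d -> design_iso B D.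
    by move=> cD /eqP eG; apply: iso (pr 8) erefl e8 _; rewrite eG.
  left; case/or4P: Gt => eG; first by left; apply: isoD c1 eG.
  - by right; left; apply: isoD c2 eG.
  - by right; right; left; apply: isoD c3 eG.
  by right; right; right; apply: isoD c4 eG.
- right; right; exists 'I_7, (design_of 7 cofano); right; split=> //; apply: iso po erefl o8 _.
  by rewrite (eqP Gt); apply: perm_trans (codes_add_full_point _) (perm_map _ pcF).
Qed.

Theorem theorem6 (X : finType) (B : {set {set X}}) (v k l : nat)
    (hD : pseudo_design B v k l) :
  (k = l + 1 ->
     exists (Y : finType) (C : {set {set Y}}),
       (symmetric_design C (v - 1) 1 0 \/
        symmetric_design C (v - 1) (v - 2) (v - 3)) /\
       (design_iso B (add_isolated_point C) \/
        design_iso B (add_full_point C)))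
  /\
  (k = l + 2 ->
     (design_iso B D1 \/ design_iso B D2 \/
      design_iso B D3 \/ design_iso B D4)
     \/
     (exists (Y : finType) (C : {set {set Y}}) (c : {set Y}),
        (symmetric_design C 7 4 2 \/ symmetric_design C 7 3 1) /\
        c \in C /\ design_iso B (C :\ c))
     \/
     (exists (Y : finType) (C : {set {set Y}}),
        (symmetric_design C 7 3 1 /\ design_iso B (add_isolated_point C)) \/
        (symmetric_design C 7 4 2 /\ design_iso B (add_full_point C)))).
Proof.
split=> kE; subst k; first exact: pseudo_design_succ hD.
exact: pseudo_design_add2 hD (pseudo_design_order hD).
Qed.
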